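(* Let $c\ge1$ be a fixed integer and $\theta>0$ a fixed real number. Let $(N_k)_{k\ge1}$ and $(m_k)_{k\ge1}$ be sequences of positive integers with $N_k\to\infty$, $m_k/(\theta N_k^{1/2})\to1$, and $c\le m_k$, $c\le N_k-m_k$ for all $k$. Let $Y_k$ be a random variable with the maximum negative hypergeometric distribution with parameters $(N_k,m_k,c)$. Then, as $k\to\infty$, $\theta Y_k/N_k^{1/2}$ converges in distribution to the sum of $c$ independent standard exponential random variables, i.e. to the distribution on $(0,\infty)$ with density $x^{c-1}e^{-x}/\Gamma(c)$.
   Context: For a real number $z$ and integer $k\ge1$, $z^{(k)}=z(z-1)\cdots(z-k+1)$ is the falling factorial, and $z^{(0)}=1$. Maximum negative hypergeometric distribution with integer parameters $(N,m,c)$, where $1\le c\le m<N$ and $c\le N-m$: an urn contains $N$ balls, $m$ of one color and $N-m$ of another; balls are drawn without replacement until at least $c$ balls of both colors have been observed; $Y$ is the number of draws needed minus $2c$. Its probability mass function is $$\Pr[Y=y]=\binom{2c+y-1}{c-1}\,\frac{m^{(c+y)}(N-m)^{(c)}+m^{(c)}(N-m)^{(c+y)}}{N^{(2c+y)}},\qquad 0\le y\le\max\{m-c,\,N-m-c\},$$ and $\Pr[Y=y]=0$ for other $y$. *)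

(* Defs.v *)
From HB Require Import structures.
From mathcomp Require Import all_boot all_order all_algebra.
From mathcomp Require Import all_classical all_reals all_analysis.

Set Implicit Arguments.
Unset Strict Implicit.
Unset Printing Implicit Defensive.

Import Order.TTheory GRing.Theory Num.Theory.
Import numFieldNormedType.Exports.

Local Open Scope classical_set_scope.
Local Open Scope ring_scope.

(** Law of the number of draws, minus [2 * c], needed to see at least [c] balls of both
    colours when drawing without replacement from an urn with [m] balls of one
    colour and [N - m] of the other.  Meaningful for [0 < c <= m < N] and
    [c <= N - m], so that the natural-number subtractions below are exact. *)
Definition max_neg_hypergeo_pmf (R : realType) (N m c y : nat) : R :=
  if (y <= maxn (m - c) (N - m - c))%N then
    'C(2 * c + y - 1, c - 1)%:R *
    ((m ^_ (c + y))%:R * ((N - m) ^_ c)%:R +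
     (m ^_ c)%:R * ((N - m) ^_ (c + y))%:R) / (N ^_ (2 * c + y))%:R
  else 0.

Definition has_max_neg_hypergeo_law (R : realType) (d : measure_display)
    (T : measurableType d) (P : probability T R) (N m c : nat)
    (Y : {RV P >-> nat}) : Prop :=
  forall y : nat, distribution P Y [set y] = (max_neg_hypergeo_pmf R N m c y)%:E.

Section normalized.
Context (R : realType) (d : measure_display) (T : measurableType d).

Definition normalized (theta : R) (N : nat) (Y : {mfun T >-> nat}) : T -> R :=
  fun t => theta * (Y t)%:R / Num.sqrt N%:R.

Variables (theta : R) (N : nat) (Y : {mfun T >-> nat}).

Let measurable_normalized : measurable_fun setT (normalized theta N Y).
Proof.
apply: (measurableT_comp (f := fun n : nat => theta * n%:R / Num.sqrt N%:R)) => //.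
Qed.

HB.instance Definition _ :=
  isMeasurableFun.Build _ _ T R (normalized theta N Y) measurable_normalized.

End normalized.

Section sumRV.
Context (R : realType) (d : measure_display) (T : measurableType d).

Definition sumRV (n : nat) (E : 'I_n -> {mfun T >-> R}) : T -> R :=
  fun t => \sum_(i < n) E i t.

Variables (n : nat) (E : 'I_n -> {mfun T >-> R}).

Let measurable_sumRV : measurable_fun setT (sumRV E).
Proof. exact: measurable_sum. Qed.

HB.instance Definition _ :=
  isMeasurableFun.Build _ _ T R (sumRV E) measurable_sumRV.

End sumRV.

(** Convergence in distribution to the law [Q] : convergence of the cumulative
    distribution functions at every continuity point of that of [Q].  The
    variables may live on different probability spaces. *)
Definition cvg_in_distribution (R : realType) (d : nat -> measure_display)
    (T : forall k, measurableType (d k)) (P : forall k, probability (T k) R)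
    (X : forall k, {RV (P k) >-> R}) (Q : set R -> \bar R) : Prop :=
  forall x : R, {for x, continuous (fun t : R => Q `]-oo, t]%classic)} ->
    cdf (X k) x @[k --> \oo] --> Q `]-oo, x]%classic.

Definition mutually_independent (R : realType) (d : measure_display)
    (T : measurableType d) (P : probability T R) (I : finType)
    (E : I -> {RV P >-> R}) : Prop :=
  forall (J : {set I}) (A : I -> set R), (forall i, measurable (A i)) ->
    P (\bigcap_(i in [set` J]) (E i @^-1` A i)) =
    (\prod_(i in J) P (E i @^-1` A i))%E.

Definition Gamma (R : realType) (s : R) : R :=
  \int[lebesgue_measure]_(x in `]0, +oo[) (x `^ (s - 1) * expR (- x)).

Definition gamma_pdf (R : realType) (c : nat) : R -> R :=
  (fun x => x ^+ (c - 1) * expR (- x) / Gamma c%:R) \_ `]0, +oo[.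

Definition gamma_prob (R : realType) (c : nat) (A : set R) : \bar R :=
  (\int[lebesgue_measure]_(x in A) (gamma_pdf c x)%:E)%E.

(* Main.v *)
Require Import Defs.
From HB Require Import structures.
From mathcomp Require Import all_boot all_order all_algebra.
From mathcomp Require Import all_classical all_reals all_analysis.
From mathcomp Require Import measurable_realfun zify ring.

Set Implicit Arguments.
Unset Strict Implicit.
Unset Printing Implicit Defensive.

Import Order.TTheory GRing.Theory Num.Theory.
Import numFieldNormedType.Exports.

Local Open Scope classical_set_scope.
Local Open Scope ring_scope.

(** Write [M = N - m] and [n = 2 * c + y].  The event [Y > y] says that after [n]
    draws some colour has been seen fewer than [c] times, so
    [Pr[Y <= y] = 1 - A n - B n], where [A n] and [B n] are the probabilities
    that fewer than [c] of the first [n] balls come from the [m] balls and from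
    the [M] balls, respectively.  Conversely, [A n - A n.+1] is the probability
    that the [c]-th ball of the first colour is drawn at time [n.+1], which is
    one of the two terms of the mass function; hence the mass function telescopes
    ([undecidedS], [sum_max_neg_hypergeo_pmf]).  Working with the distribution
    function leaves finitely many terms, and no Riemann sum is needed.

    In the scaling [m ~ theta * sqrt N], [n ~ (x / theta) * sqrt N], the [j]-th
    term of [A n] is the product of a factor that tends to [x ^ j / j!] and of
    [M ^_ (n - j) / (N - j) ^_ (n - j)], a product of about [n] factors
    [1 - m / N] up to smaller order, which tends to [exp (- x)]
    ([cvg_few_draws_term]).  As for [B n], it is nonincreasing in [n], and its
    value at [n = 2 * c] tends to [0] because [m / N] does.  So the distribution
    function tends to [1 - exp (- x) * \sum_(j < c) x ^ j / j!]
    ([cvg_cdf_normalized]).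

    That limit is the Erlang distribution function.  It belongs to the gamma law
    because [- exp (- x) * \sum_(j < c.+1) x ^ j / j!] is an antiderivative of
    [x ^ c / c! * exp (- x)] ([is_derive_erlang_ccdf], [gamma_prob_cdf]).  It
    belongs to the sum of [c] independent exponential variables by induction on
    [c]: the sum of all but one of the variables is independent of the last one
    ([independent_set_sumRV]), and convolution with an exponential law raises
    the index of an Erlang distribution function by one ([erlang_cdf_conv]).
    A law on the line is determined by its distribution function, which
    identifies the two limits. *)

(** * Counting ordered draws *)

(** The number of ordered draws of [n] balls, without replacement from [m] balls
    of one colour and [M] of the other, in which the first colour occurs fewer
    than [c] times. *)
Definition few_draws (m M c n : nat) : nat :=
  (\sum_(j < c) 'C(n, j) * (m ^_ j * M ^_ (n - j)))%N.

(** Extend each of these draws by one ball: the number of extensions is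
    [m + M - n], and an extension stops having fewer than [c.+1] balls of the first
    colour exactly when there were [c] of them and the new ball is one more. *)
Lemma few_drawsS (m M c n : nat) :
  ((m + M - n) * few_draws m M c.+1 n =
   few_draws m M c.+1 n.+1 + 'C(n, c) * (m ^_ c.+1 * M ^_ (n - c)))%N.
Proof.
(* Both sides vanish when a truncated difference would be wrong. *)
have term j : (j <= n)%N -> ((m + M - n) * (m ^_ j * M ^_ (n - j)) =
    m ^_ j.+1 * M ^_ (n - j) + m ^_ j * M ^_ (n.+1 - j))%N.
  move=> jn; have [jm|mj] := leqP j m; last first.
    by rewrite (ffact_small mj) (@ffact_small m j.+1) ?muln0 ?mul0n//; lia.
  have [njM|Mnj] := leqP (n - j) M; last first.
    by rewrite (ffact_small Mnj) (@ffact_small M (n.+1 - j)) ?muln0//; lia.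
  by rewrite subSn// !ffactnSr; have -> : (m + M - n = (m - j) + (M - (n - j)))%N;
    [lia|ring].
rewrite /few_draws; elim: c => [|c IHc].
  rewrite !big_ord_recl !big_ord0 !addn0 !bin0 !mul1n.
  by have := term 0%N isT; rewrite /= !subn0 ffactn0 !mul1n => ->; rewrite addnC.
rewrite big_ord_recr/= mulnDr IHc.
rewrite [X in (_ = X + _)%N]big_ord_recr/=.
have [cn|nc] := leqP c.+1 n; last first.
  by rewrite binS !(@bin_small n c.+1)// !mul0n muln0 !addn0.
by rewrite [((m + M - n) * _)%N]mulnCA term// binS subSS; ring.
Qed.

Lemma few_draws_all (m M c n : nat) : (n < c)%N ->
  few_draws m M c n = ((m + M) ^_ n)%N.
Proof.
case: c => // c; elim: n => [_|n IHn nc].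
  by rewrite /few_draws big_ord_recl big1 ?addn0 ?bin0// => i _; rewrite bin0n mul0n.
have := few_drawsS m M c n; rewrite (@bin_small n c)// mul0n addn0 => <-.
by rewrite IHn 1?ltnW// mulnC ffactnSr.
Qed.

(** Among [2 * c - 1] balls exactly one of the two colours occurs fewer than [c]
    times.  This is where the telescoping sum starts, at total mass one. *)
Lemma few_draws_split (m M c : nat) : (0 < c)%N ->
  (few_draws m M c (2 * c - 1) + few_draws M m c (2 * c - 1) =
   (m + M) ^_ (2 * c - 1))%N.
Proof.
move=> c0; rewrite -(@few_draws_all m M (c + c)); last by lia.
rewrite [RHS]/few_draws big_split_ord/=; congr (_ + _)%N.
rewrite /few_draws (reindex_inj rev_ord_inj)/=; apply: eq_bigr => i _.
have ic := ltn_ord i.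
have -> : (c - i.+1 = (2 * c - 1) - (c + i))%N by lia.
rewrite bin_sub; last by lia.
by rewrite subKn ?[(M ^_ _ * _)%N]mulnC//; lia.
Qed.

(** The left-hand side is the probability that the [c]-th ball of the first
    colour is the [n.+1]-st ball drawn. *)
Lemma few_draws_ratioS (R : realType) (N a b c n : nat) :
  (0 < c)%N -> (a + b = N)%N -> (n < N)%N ->
  (few_draws a b c n)%:R / (N ^_ n)%:R - (few_draws a b c n.+1)%:R / (N ^_ n.+1)%:R
  = 'C(n, c - 1)%:R * ((a ^_ c)%:R * (b ^_ (n.+1 - c))%:R) / (N ^_ n.+1)%:R :> R.
Proof.
move=> c0 abN nN; have := few_drawsS a b (c - 1) n.
rewrite subn1 prednK// => /(congr1 (fun x => x%:R : R)).
rewrite ffactnSr abN natrM natrD !natrM; have -> : (n - c.-1 = n.+1 - c)%N by lia.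
move=> E; have Nn0 : (N ^_ n)%:R != 0 :> R by rewrite pnatr_eq0 -lt0n ffact_gt0 ltnW.
have Nn1 : (N - n)%:R != 0 :> R by rewrite pnatr_eq0 -lt0n subn_gt0.
have -> : 'C(n, c.-1)%:R * ((a ^_ c)%:R * (b ^_ (n.+1 - c))%:R) =
    (N - n)%:R * (few_draws a b c n)%:R - (few_draws a b c n.+1)%:R :> R.
  by rewrite E addrC addKr.
by field; rewrite Nn1 Nn0.
Qed.

Section urn.
Variables (R : realType) (N m c : nat).
Hypotheses (c0 : (0 < c)%N) (cm : (c <= m)%N) (cM : (c <= N - m)%N).

(** The probability that [n >= 2 * c - 1] draws have not yet produced [c] balls of
    each colour. *)
Definition undecided (n : nat) : R :=
  (few_draws m (N - m) c n + few_draws (N - m) m c n)%:R / (N ^_ n)%:R.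

Lemma undecidedS (n : nat) : (n < N)%N ->
  undecided n - undecided n.+1 =
  'C(n, c - 1)%:R * ((m ^_ (n.+1 - c))%:R * ((N - m) ^_ c)%:R +
     (m ^_ c)%:R * ((N - m) ^_ (n.+1 - c))%:R) / (N ^_ n.+1)%:R.
Proof.
move=> nN; rewrite /undecided !natrD !mulrDl opprD addrACA.
rewrite !few_draws_ratioS//; [by ring|by lia|by lia].
Qed.

Lemma sum_max_neg_hypergeo_pmf (y : nat) :
  (y <= maxn (m - c) (N - m - c))%N ->
  \sum_(i < y.+1) max_neg_hypergeo_pmf R N m c i = 1 - undecided (2 * c + y).
Proof.
move=> ymax; rewrite -[1](_ : undecided (2 * c - 1) = 1); last first.
  rewrite /undecided few_draws_split//; have -> : (m + (N - m) = N)%N by lia.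
  by rewrite divff// pnatr_eq0 -lt0n ffact_gt0; lia.
have pmfE i : (i <= y)%N -> max_neg_hypergeo_pmf R N m c i =
    undecided (2 * c + i - 1) - undecided (2 * c + i).
  move=> iy; rewrite /max_neg_hypergeo_pmf (leq_trans iy ymax).
  have iE : (2 * c + i = (2 * c + i - 1).+1)%N by lia.
  rewrite [in undecided (2 * c + i)]iE undecidedS; last by lia.
  by rewrite -iE; have -> : (2 * c + i - c = c + i)%N by lia.
elim: y {ymax} pmfE => [|y IHy] pmfE.
  by rewrite big_ord1 pmfE// addn0.
rewrite big_ord_recr/= IHy => [|i iy]; last by apply: pmfE; rewrite ltnW.
rewrite pmfE//; have -> : (2 * c + y.+1 - 1 = 2 * c + y)%N by lia.
by ring.
Qed.

End urn.

(** * Falling factorials at the scale of a square root *)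

Lemma ffactnD (n i j : nat) : (n ^_ (i + j) = n ^_ i * (n - i) ^_ j)%N.
Proof.
elim: j => [|j IHj]; first by rewrite addn0 muln1.
by rewrite addnS ffactnSr IHj (ffactnSr (n - i)) mulnA subnDA.
Qed.

(** Each of the [b] factors is [1 - d / (A - i) <= exp (- d / A)]. *)
Lemma ffact_ratio_le (R : realType) (A d b : nat) : (d + b <= A)%N ->
  ((A - d) ^_ b)%:R / (A ^_ b)%:R <= expR (- (b%:R * d%:R / A%:R)) :> R.
Proof.
elim: b => [|b IHb] dbA; first by rewrite !mul0r oppr0 expR0 divr1.
have Ab0 : 0 < (A - b)%:R :> R by rewrite ltr0n; lia.
have A0 : 0 < A%:R :> R by rewrite ltr0n; lia.
have -> : - (b.+1%:R * d%:R / A%:R) =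
    - (b%:R * d%:R / A%:R) + - (d%:R / A%:R) :> R.
  by rewrite -addn1 natrD; ring.
rewrite expRD !ffactnSr !natrM invfM mulrACA ler_pM ?IHb//; last 1 first.
- apply: le_trans (expR_ge1Dx _).
  have -> : (A - d - b)%:R = (A - b)%:R - d%:R :> R by rewrite -natrB; [congr (_%:R); lia|lia].
  rewrite mulrBl divff ?gt_eqF// lerD2l lerN2 ler_wpM2l// lef_pV2 ?posrE//.
  by rewrite ler_nat leq_subr.
- by lia.
Qed.

(** Each factor is the inverse of [1 + d / (A - d - i)], which is at most
    [exp (d / (A - d - b))]. *)
Lemma ffact_ratio_ge (R : realType) (A d b : nat) : (d + b < A)%N ->
  expR (- (b%:R * d%:R / (A - d - b)%:R)) <= ((A - d) ^_ b)%:R / (A ^_ b)%:R :> R.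
Proof.
move=> dbA; have M0 : 0 < (A - d - b)%:R :> R by rewrite ltr0n; lia.
suff H i : (i <= b)%N -> expR (- (i%:R * d%:R / (A - d - b)%:R)) <=
  ((A - d) ^_ i)%:R / (A ^_ i)%:R :> R by exact: H.
elim: i => [|i IHi] ib; first by rewrite !mul0r oppr0 expR0 divr1.
have Mi0 : 0 < (A - d - i)%:R :> R by rewrite ltr0n; lia.
have Ai0 : 0 < (A - i)%:R :> R by rewrite ltr0n; lia.
have -> : - (i.+1%:R * d%:R / (A - d - b)%:R) =
    - (i%:R * d%:R / (A - d - b)%:R) + - (d%:R / (A - d - b)%:R) :> R.
  by rewrite -addn1 natrD; ring.
rewrite expRD !ffactnSr !natrM invfM mulrACA ler_pM ?expR_ge0 ?IHi//; last 1 first.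
- rewrite expRN -[X in _ <= X]invrK lef_pV2 ?posrE ?expR_gt0 ?invr_gt0 ?divr_gt0//.
  rewrite invf_div; apply: le_trans (expR_ge1Dx _).
  have -> : (A - i)%:R = (A - d - i)%:R + d%:R :> R by rewrite -natrD; congr (_%:R); lia.
  rewrite mulrDl divff ?gt_eqF// lerD2l ler_wpM2l// lef_pV2 ?posrE//.
  by rewrite ler_nat; lia.
- by lia.
Qed.

(** Truncated subtraction of a constant is invisible at an infinite scale. *)
Lemma cvg_subn_scale (R : realType) (a : nat -> nat) (s : nat -> R) (l : R) (i : nat) :
  s k @[k --> \oo] --> +oo -> (a k)%:R / s k @[k --> \oo] --> l ->
  (a k - i)%:R / s k @[k --> \oo] --> l.
Proof.
move=> soo al; have s0 : \forall k \near \oo, 0 < s k by exact: (cvgryPgt _).1.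
apply: (@squeeze_cvgr _ _ _ _ (fun k => (a k)%:R / s k - i%:R * (s k)^-1)
  (fun k => (a k)%:R / s k)) => //.
- near=> k; have sk0 : 0 < s k by near: k.
  rewrite -mulrBl !ler_pM2r ?invr_gt0// lerBlDr -natrD !ler_nat.
  by rewrite leq_subr andbT; lia.
- rewrite -[l]subr0 -(mulr0 i%:R); apply: cvgB => //; apply: cvgMl_tmp.
  exact: (gtr0_cvgV0 s0).2.
Unshelve. all: by end_near. Qed.

Lemma cvg_ffact_scale (R : realType) (a : nat -> nat) (s : nat -> R) (l : R) (j : nat) :
  s k @[k --> \oo] --> +oo -> (a k)%:R / s k @[k --> \oo] --> l ->
  (a k ^_ j)%:R / s k ^+ j @[k --> \oo] --> l ^+ j.
Proof.
move=> soo al; elim: j => [|j IHj].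
  under eq_fun do rewrite ffactn0 expr0 divr1; exact: cvg_cst.
rewrite exprSr; under eq_fun do rewrite ffactnSr natrM exprSr invfM mulrACA.
by apply: cvgM => //; exact: cvg_subn_scale.
Qed.

Lemma eq_near_cvg (R : realType) (f g : nat -> R) (l l' : R) :
  f k @[k --> \oo] --> l -> l = l' -> (\forall k \near \oo, f k = g k) ->
  g k @[k --> \oo] --> l'.
Proof. by move=> fl <- fg; apply: cvg_trans fl; exact: near_eq_cvg. Qed.

Section scaling.
Variables (R : realType) (N : nat -> nat).
Hypothesis N_cvg : N k @[k --> \oo] --> \oo.

Lemma cvg_natr_pinfty : ((N k)%:R : R) @[k --> \oo] --> +oo.
Proof. exact/cvgrnyP. Qed.

Lemma cvg_sqrt_natr_pinfty : (Num.sqrt (N k)%:R : R) @[k --> \oo] --> +oo.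
Proof.
apply/cvgryPge => A; have /cvgryPge/(_ (A ^+ 2)) := cvg_natr_pinfty.
apply: filterS => k /ler_wsqrtr; apply: le_trans.
by rewrite sqrtr_sqr ler_norm.
Qed.

Lemma cvg_over_natr (a : nat -> nat) (l : R) :
  (a k)%:R / Num.sqrt (N k)%:R @[k --> \oo] --> l ->
  ((a k)%:R / (N k)%:R : R) @[k --> \oo] --> (0 : R).
Proof.
move=> al; have s0 : \forall k \near \oo, 0 < Num.sqrt (N k)%:R :> R.
  by apply: (cvgryPgt _).1; exact: cvg_sqrt_natr_pinfty.
apply: (eq_near_cvg (cvgM al ((gtr0_cvgV0 s0).2 cvg_sqrt_natr_pinfty)));
  first exact: mulr0.
near=> k.
by rewrite /= -mulrA -invfM -expr2 sqr_sqrtr.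
Unshelve. all: by end_near. Qed.

Lemma cvg_natr_ratio1 : ((N k)%:R / (N k)%:R : R) @[k --> \oo] --> (1 : R).
Proof.
have N0 : \forall k \near \oo, 0 < (N k)%:R :> R.
  by apply: (cvgryPgt _).1; exact: cvg_natr_pinfty.
by apply: cvg_near_cst; near=> k; rewrite divff ?gt_eqF//; near: k.
Unshelve. all: by end_near. Qed.

Variables (theta u : R) (m n : nat -> nat).
Hypothesis m_cvg : (m k)%:R / Num.sqrt (N k)%:R @[k --> \oo] --> theta.
Hypothesis n_cvg : (n k)%:R / Num.sqrt (N k)%:R @[k --> \oo] --> u.

(** [m] and [n] are of order [sqrt N], so that [N] eventually exceeds any
    quantity of that order; this keeps all truncated subtractions exact. *)
Lemma near_room (C : nat) : \forall k \near \oo, (m k + n k + C < N k)%N.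
Proof.
have N0 : \forall k \near \oo, 0 < (N k)%:R :> R.
  by apply: (cvgryPgt _).1; exact: cvg_natr_pinfty.
have lim : ((m k + n k + C)%:R / (N k)%:R : R) @[k --> \oo] --> (0 : R).
  apply: (eq_near_cvg (cvgD (cvgD (cvg_over_natr m_cvg) (cvg_over_natr n_cvg))
    (cvgMl_tmp (a := C%:R) ((gtr0_cvgV0 N0).2 cvg_natr_pinfty)))); first by rewrite mulr0 !addr0.
  by near=> k; rewrite !fctE -!mulrDl -!natrD.
near=> k; have Nk0 : 0 < (N k)%:R :> R by near: k.
rewrite -(ltr_nat R) -[ltRHS]mul1r -ltr_pdivrMr//; near: k.
exact: cvgr_lt lim _ ltr01.
Unshelve. all: by end_near. Qed.

Lemma cvg_room (j : nat) :
  ((N k - m k - (n k - j))%:R / (N k)%:R : R) @[k --> \oo] --> (1 : R).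
Proof.
have nj := cvg_subn_scale j cvg_sqrt_natr_pinfty n_cvg.
apply: (eq_near_cvg (cvgB cvg_natr_ratio1
  (cvgD (cvg_over_natr m_cvg) (cvg_over_natr nj)))); first by rewrite addr0 subr0.
near=> k; rewrite !fctE -mulrDl -mulrBl -natrD -natrB; last first.
  have : (m k + n k + 0 < N k)%N by near: k; exact: near_room.
  by lia.
by rewrite subnDA.
Unshelve. all: by end_near. Qed.

(** The two exponential bounds on this product have exponents
    [- (n - j) * (m - j) / D], with [D = N - m - (n - j)] in the lower bound and
    [D = N - j] in the upper one; both are equivalent to [N]. *)
Lemma cvg_ffact_ratio (j : nat) : (forall k, (j <= m k)%N) ->
  (forall k, (m k <= N k)%N) ->
  (((N k - m k) ^_ (n k - j))%:R / ((N k - j) ^_ (n k - j))%:R : R) @[k --> \oo]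
  --> expR (- (theta * u)).
Proof.
move=> jm mN; have soo := cvg_sqrt_natr_pinfty.
have num : ((n k - j)%:R * (m k - j)%:R / (N k)%:R : R) @[k --> \oo] --> theta * u.
  apply: (eq_near_cvg (cvgM (cvg_subn_scale j soo n_cvg)
    (cvg_subn_scale j soo m_cvg))); first exact: mulrC.
  near=> k.
  by rewrite /= mulrACA -invfM -expr2 sqr_sqrtr.
have expo (B : nat -> nat) : ((B k)%:R / (N k)%:R : R) @[k --> \oo] --> (1 : R) ->
    expR (- ((n k - j)%:R * (m k - j)%:R / (B k)%:R)) @[k --> \oo] -->
    expR (- (theta * u)).
  move=> B1; apply: continuous_cvg; first exact: continuous_expR.
  apply: cvgN; apply: (eq_near_cvg (cvgM num (cvgV (oner_neq0 R) B1)));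
    first by rewrite invr1 mulr1.
  near=> k.
  have Nk0 : (N k)%:R != 0 :> R.
    rewrite pnatr_eq0; suff : (m k + n k + 0 < N k)%N by lia.
    by near: k; exact: near_room.
  by rewrite /= invf_div mulrA divfK.
apply: squeeze_cvgr; last 2 first.
- exact: (expo (fun k => (N k - m k - (n k - j))%N) (cvg_room j)).
- apply: (expo (fun k => (N k - j)%N)).
  exact: cvg_subn_scale cvg_natr_pinfty cvg_natr_ratio1.
- near=> k; have room : (m k + n k + j < N k)%N by near: k; exact: near_room.
  have jmk := jm k; have E : (N k - m k = (N k - j) - (m k - j))%N by lia.
  by rewrite E ffact_ratio_ge ?ffact_ratio_le//; lia.
Unshelve. all: by end_near. Qed.

(** Split [N ^_ n] as [N ^_ j * (N - j) ^_ (n - j)]: the first factor goes with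
    ['C(n, j) * m ^_ j], of order [(n * m / N) ^ j / j!], and the second one with
    [(N - m) ^_ (n - j)]. *)
Lemma cvg_few_draws_term (j : nat) : (forall k, (j <= m k)%N) ->
  (forall k, (m k <= N k)%N) -> (forall k, (j <= n k)%N) ->
  (('C(n k, j) * (m k ^_ j * (N k - m k) ^_ (n k - j)))%:R / (N k ^_ n k)%:R : R)
    @[k --> \oo] --> expR (- (theta * u)) * ((theta * u) ^+ j / j`!%:R).
Proof.
move=> jm mN jn; have soo := cvg_sqrt_natr_pinfty.
have nj := cvg_ffact_scale (j := j) soo n_cvg.
have mj := cvg_ffact_scale (j := j) soo m_cvg.
have Nj := cvg_ffact_scale (j := j) cvg_natr_pinfty cvg_natr_ratio1.
rewrite expr1n in Nj.
apply: (eq_near_cvg (cvgM (cvg_ffact_ratio jm mN)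
  (cvgMl_tmp (a := j`!%:R^-1) (cvgM (cvgM mj nj) (cvgV (oner_neq0 R) Nj)))));
  first by rewrite invr1 mulr1 -exprMn [_^-1 * _]mulrC.
near=> k.
have room : (m k + n k + j < N k)%N by near: k; exact: near_room.
have Nk0 : 0 < (N k)%:R :> R by rewrite ltr0n; lia.
have sk0 : Num.sqrt (N k)%:R != 0 :> R by rewrite gt_eqF// sqrtr_gt0.
have sE : (N k)%:R ^+ j = Num.sqrt (N k)%:R ^+ j * Num.sqrt (N k)%:R ^+ j :> R.
  by rewrite -exprMn -expr2 sqr_sqrtr// ltW.
have j0 : j`!%:R != 0 :> R by rewrite pnatr_eq0 -lt0n fact_gt0.
have Nj0 : (N k ^_ j)%:R != 0 :> R by rewrite pnatr_eq0 -lt0n ffact_gt0; lia.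
have Nnj0 : ((N k - j) ^_ (n k - j))%:R != 0 :> R.
  by rewrite pnatr_eq0 -lt0n ffact_gt0; lia.
have -> : (N k ^_ n k = N k ^_ j * (N k - j) ^_ (n k - j))%N.
  by rewrite -ffactnD subnKC.
rewrite /= -(bin_ffact (n k) j) !natrM sE.
move: (Num.sqrt _) sk0 => s s0.
by field; rewrite Nj0 Nnj0 j0 expf_neq0.
Unshelve. all: by end_near. Qed.

End scaling.

(** The probability that a Poisson variable of parameter [x] is less than [c],
    which is also the probability that a sum of [c] independent standard
    exponential variables exceeds [x]. *)
Definition erlang_ccdf (R : realType) (c : nat) (x : R) : R :=
  expR (- x) * \sum_(j < c) x ^+ j / j`!%:R.

Lemma few_draws_ratio_nonincreasing (R : realType) (N a b c n n' : nat) :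
  (0 < c)%N -> (a + b = N)%N -> (n <= n')%N -> (n' <= N)%N ->
  (few_draws a b c n')%:R / (N ^_ n')%:R <=
  (few_draws a b c n)%:R / (N ^_ n)%:R :> R.
Proof.
move=> c0 abN; elim: n' => [|n' IHn']; first by rewrite leqn0 => /eqP ->.
rewrite leq_eqVlt => /predU1P[->//|]; rewrite ltnS => nn' n'N.
apply: le_trans (IHn' nn' (ltnW n'N)).
by rewrite -subr_ge0 few_draws_ratioS// divr_ge0// mulr_ge0// mulr_ge0.
Qed.

Lemma cvg_undecided (R : realType) (c : nat) (N m n : nat -> nat) (theta u : R) :
  (0 < c)%N -> N k @[k --> \oo] --> \oo ->
  (m k)%:R / Num.sqrt (N k)%:R @[k --> \oo] --> theta ->
  (n k)%:R / Num.sqrt (N k)%:R @[k --> \oo] --> u ->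
  (forall k, (c <= m k)%N) -> (forall k, (m k <= N k)%N) ->
  (forall k, (2 * c <= n k)%N) ->
  undecided R (N k) (m k) c (n k) @[k --> \oo] --> erlang_ccdf c (theta * u).
Proof.
move=> c0 N_cvg m_cvg n_cvg cm mN cn.
have minority : (few_draws (m k) (N k - m k) c (n k))%:R / (N k ^_ n k)%:R
    @[k --> \oo] --> erlang_ccdf c (theta * u).
  rewrite /erlang_ccdf /few_draws mulr_sumr.
  under eq_fun do rewrite natr_sum mulr_suml.
  apply: cvg_big; first exact: add_continuous.
  move=> j _; have jc := ltn_ord j.
  apply: cvg_few_draws_term => // k; last by have := cn k; lia.
  by apply: leq_trans (cm k); exact: ltnW.
(* Every term contains the factor [(m / N) ^ (2 * c - j)], with positive exponent;
   monotonicity in [n] transfers the limit from [2 * c] to [n k]. *)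
have majority2 : (few_draws (N k - m k) (m k) c (2 * c))%:R / (N k ^_ (2 * c))%:R
    @[k --> \oo] --> (0 : R).
  have Noo : ((N k)%:R : R) @[k --> \oo] --> +oo := cvg_natr_pinfty (R := R) N_cvg.
  have N0 : \forall k \near \oo, 0 < (N k)%:R :> R by exact: (cvgryPgt _).1.
  have mN0 := cvg_over_natr N_cvg m_cvg.
  have MN1 : (N k - m k)%:R / (N k)%:R @[k --> \oo] --> (1 : R).
    apply: (eq_near_cvg (cvgB (cvg_natr_ratio1 (R := R) N_cvg) mN0)); first exact: subr0.
    by near=> k; rewrite fctE -mulrBl -natrB.
  have N1 := cvg_ffact_scale (j := 2 * c) Noo (cvg_natr_ratio1 (R := R) N_cvg).
  have -> : 0 = \sum_(j < c) 0 :> R by rewrite big1.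
  rewrite /few_draws; under eq_fun do rewrite natr_sum mulr_suml.
  apply: cvg_big; first exact: add_continuous.
  move=> j _; have jc := ltn_ord j; rewrite expr1n in N1.
  apply: (eq_near_cvg (cvgMl_tmp (a := 'C(2 * c, j)%:R) (cvgM
    (cvgM (cvg_ffact_scale (j := j) Noo MN1) (cvg_ffact_scale (j := 2 * c - j) Noo mN0))
    (cvgV (oner_neq0 R) N1)))).
    by rewrite expr0n subn_eq0 leqNgt (_ : j < 2 * c)%N ?mulr0 ?mul0r ?mulr0//; lia.
  near=> k; have Nk0 : (N k)%:R != 0 :> R by rewrite gt_eqF//; near: k.
  have NE : (N k)%:R ^+ (2 * c) = (N k)%:R ^+ j * (N k)%:R ^+ (2 * c - j) :> R.
    by rewrite -exprD subnKC//; lia.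
  have NN : (N k ^_ (2 * c))%:R != 0 :> R.
    rewrite pnatr_eq0 -lt0n ffact_gt0; apply: leq_trans (cn k) _.
    suff : (m k + n k + 0 < N k)%N by lia.
    by near: k; exact: (near_room N_cvg m_cvg n_cvg).
  rewrite /= !natrM NE; move: (N k ^_ (2 * c))%:R NN => w w0.
  by field; rewrite w0 !expf_neq0.
rewrite -[erlang_ccdf _ _]addr0.
rewrite /undecided; under eq_fun do rewrite natrD mulrDl.
apply: cvgD => //; apply: squeeze_cvgr (cvg_cst 0) majority2.
near=> k; rewrite divr_ge0//=; apply: few_draws_ratio_nonincreasing => //.
  by rewrite subnK.
suff : (m k + n k + 0 < N k)%N by lia.
by near: k; exact: (near_room N_cvg m_cvg n_cvg).
Unshelve. all: by end_near. Qed.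

(** * The Erlang distribution function *)

Definition erlang_pdf (R : realType) (c : nat) (x : R) : R :=
  x ^+ c / c`!%:R * expR (- x).

Definition erlang_cdf (R : realType) (n : nat) (t : R) : R :=
  if 0 <= t then 1 - erlang_ccdf n t else 0.

Lemma erlang_ccdfS (R : realType) (c : nat) (x : R) :
  erlang_ccdf c.+1 x = erlang_ccdf c x + erlang_pdf c x.
Proof. by rewrite /erlang_ccdf big_ord_recr/= mulrDr [in X in _ + X]mulrC. Qed.

Lemma erlang_ccdf0 (R : realType) (c : nat) : erlang_ccdf c.+1 (0 : R) = 1.
Proof.
rewrite /erlang_ccdf oppr0 expR0 mul1r big_ord_recl big1 ?addr0 ?divr1// => i _.
by rewrite expr0n/= mul0r.
Qed.

(** In the derivative of the sum all terms cancel but the last one. *)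
Lemma is_derive_erlang_ccdf (R : realType) (c : nat) (x : R) :
  is_derive x 1 (erlang_ccdf c.+1 : R -> R) (- erlang_pdf c x).
Proof.
have dexp : is_derive x 1 (fun y : R => expR (- y)) (- expR (- x)).
  by rewrite -[X in is_derive _ _ _ X](mulrN1); apply: is_derive1_comp.
elim: c => [|c IHc].
  rewrite (_ : erlang_ccdf 1 = fun y : R => expR (- y)).
    by rewrite /erlang_pdf expr0 divr1 mul1r; exact: dexp.
  by apply/funext => y; rewrite /erlang_ccdf big_ord1 expr0 fact0 divr1 mulr1.
rewrite (_ : erlang_ccdf c.+2 = erlang_ccdf c.+1 + erlang_pdf c.+1 :> (R -> R)); last first.
  by apply/funext => y; rewrite erlang_ccdfS.
rewrite (_ : erlang_pdf c.+1 = (fun y : R => c.+1`!%:R^-1 *: y ^+ c.+1) * (fun y => expR (- y))); last first.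
  by apply/funext => y; rewrite /erlang_pdf fctE; congr (_ * _); exact: mulrC.
have dX : is_derive x 1 (fun y : R => c.+1`!%:R^-1 *: y ^+ c.+1)
    (c.+1`!%:R^-1 *: (c.+1%:R * x ^+ c)).
  apply: is_deriveZ; rewrite (_ : (fun y : R => y ^+ c.+1) = id ^+ c.+1); last first.
    by apply/funext => y; rewrite exprfctE.
  apply: (is_derive_eq (is_deriveX c.+1 (is_derive_id x 1))).
  exact: mulr1.
apply: (is_derive_eq (is_deriveD IHc (is_deriveM dX dexp))).
have c0 : c`!%:R != 0 :> R by rewrite pnatr_eq0 -lt0n fact_gt0.
have c1 : c.+1%:R != 0 :> R by rewrite pnatr_eq0.
rewrite /= /erlang_pdf !fctE factS natrM exprS.
rewrite /GRing.scale/=.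
by move: c.+1%:R c1 c`!%:R c0 => a a0 b b0; field; rewrite a0 b0.
Qed.

Lemma continuous_erlang_pdf (R : realType) (c : nat) : continuous (@erlang_pdf R c).
Proof.
move=> x; apply: cvgM.
  by apply: cvgMr_tmp; exact: exprn_continuous.
apply: continuous_comp; [exact: cvgN|exact: continuous_expR].
Qed.

Lemma erlang_pdf_ge0 (R : realType) (c : nat) (x : R) : 0 <= x -> 0 <= erlang_pdf c x.
Proof. by move=> x0; rewrite mulr_ge0 ?expR_ge0// divr_ge0 ?exprn_ge0. Qed.

Section erlang.
Context {R : realType}.
Notation mu := (@lebesgue_measure R).

Lemma is_derive_continuous (f : R -> R) (x df : R) :
  is_derive x 1 f df -> {for x, continuous f}.
Proof.
by move=> [fx _]; apply: differentiable_continuous; exact/derivable1_diffP.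
Qed.

Lemma continuous_erlang_ccdf (c : nat) : continuous (@erlang_ccdf R c).
Proof.
case: c => [|c] x; last exact: is_derive_continuous (is_derive_erlang_ccdf c x).
rewrite /continuous_at /erlang_ccdf; under eq_fun do rewrite big_ord0 mulr0.
by rewrite big_ord0 mulr0; exact: cvg_cst.
Qed.

(** The bound [x ^ c.+1 / c.+1! <= exp x] gives a decay of order [1 / x]. *)
Lemma cvg_erlang_pdf_pinfty (c : nat) : @erlang_pdf R c x @[x --> +oo] --> 0.
Proof.
have lim : c.+1%:R * x^-1 @[x --> +oo] --> (0 : R).
  rewrite -[X in _ --> X](mulr0 c.+1%:R); apply: cvgMl_tmp.
  by apply: (gtr0_cvgV0 _).2; [exact: nbhs_pinfty_gt|exact: cvg_id].
apply: squeeze_cvgr (cvg_cst 0) lim; near=> x.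
have x0 : 0 < x by near: x; exact: nbhs_pinfty_gt.
rewrite (erlang_pdf_ge0 _ (ltW x0))/= /erlang_pdf expRN ler_pdivrMr ?expR_gt0//.
rewrite mulrAC ler_pdivlMr// -ler_pdivrMl ?ltr0n//.
have := expR_ge1Dxn c (ltW x0); apply: le_trans.
suff -> : c.+1%:R^-1 * (x ^+ c / c`!%:R * x) = x ^+ c.+1 / c.+1`!%:R by rewrite lerDr.
by rewrite factS natrM invfM exprS; ring.
Unshelve. all: by end_near. Qed.

Lemma cvg_erlang_ccdf_pinfty (c : nat) : @erlang_ccdf R c x @[x --> +oo] --> 0.
Proof.
elim: c => [|c IHc].
  rewrite /erlang_ccdf; under eq_fun do rewrite big_ord0 mulr0; exact: cvg_cst.
under eq_fun do rewrite erlang_ccdfS.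
rewrite -[0]addr0; apply: cvgD => //; exact: cvg_erlang_pdf_pinfty.
Qed.

Lemma integral_erlang_pdf_itv (c : nat) (t : R) : 0 < t ->
  (\int[mu]_(x in `[0%R, t]) (erlang_pdf c x)%:E = (1 - erlang_ccdf c.+1 t)%:E)%E.
Proof.
move=> t0; rewrite (@continuous_FTC2 _ _ (fun x => - erlang_ccdf c.+1 x))//.
- by rewrite -EFinB opprK erlang_ccdf0 addrC.
- by apply: continuous_subspaceT => x; exact: continuous_erlang_pdf.
- split.
  + move=> x _; exact: (@ex_derive _ _ _ _ _ _ _ (is_deriveN (is_derive_erlang_ccdf c x))).
  + apply: cvg_at_right_filter; apply: cvgN; exact: continuous_erlang_ccdf.
  + apply: cvg_at_left_filter; apply: cvgN; exact: continuous_erlang_ccdf.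
- move=> x _; rewrite derive1E.
  by have /@derive_val -> := is_deriveN (is_derive_erlang_ccdf c x); rewrite opprK.
Qed.

Lemma integral_erlang_pdf (c : nat) :
  (\int[mu]_(x in `[0%R, +oo[) (erlang_pdf c x)%:E = 1)%E.
Proof.
rewrite (@ge0_continuous_FTC2y _ _ (fun x => - erlang_ccdf c.+1 x) _ 0)//.
- by rewrite erlang_ccdf0 sub0e EFinN oppeK.
- by move=> x; exact: erlang_pdf_ge0.
- by apply: continuous_subspaceT => x; exact: continuous_erlang_pdf.
- by rewrite -oppr0; apply: cvgN; exact: cvg_erlang_ccdf_pinfty.
- move=> x _; exact: (@ex_derive _ _ _ _ _ _ _ (is_deriveN (is_derive_erlang_ccdf c x))).
- apply: cvg_at_right_filter; apply: cvgN; exact: continuous_erlang_ccdf.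
- move=> x _; rewrite derive1E.
  by have /@derive_val -> := is_deriveN (is_derive_erlang_ccdf c x); rewrite opprK.
Qed.

End erlang.

(** * The gamma law *)

Section gamma.
Context {R : realType}.
Notation mu := (@lebesgue_measure R).

Lemma measurable_EFin_erlang_pdf (c : nat) (D : set (measurableTypeR R)) :
  measurable_fun D (EFin \o @erlang_pdf R c).
Proof.
apply/measurable_EFinP/measurable_funTS; apply: continuous_measurable_fun.
exact: continuous_erlang_pdf.
Qed.

(** The Erlang density has total mass one. *)
Lemma Gamma_natr (c : nat) : Gamma c.+1%:R = c`!%:R :> R.
Proof.
rewrite /Gamma /Rintegral.
rewrite (eq_integral (fun x : measurableTypeR R => (c`!%:R%:E * (erlang_pdf c x)%:E)%E)); last first.
  move=> x; rewrite inE/= in_itv/= andbT => x0.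
  rewrite -EFinM -addn1 natrD addrK powR_mulrn ?ltW// /erlang_pdf mulrA.
  by rewrite [c`!%:R * _]mulrC divfK// pnatr_eq0 -lt0n fact_gt0.
have mf := measurable_EFin_erlang_pdf c.
rewrite ge0_integralZl_EFin//; last first.
  by move=> x; rewrite /= in_itv/= andbT => x0; rewrite lee_fin erlang_pdf_ge0// ltW.
by rewrite integral_itv_obnd_cbnd; [rewrite (integral_erlang_pdf c) mule1|exact: mf].
Qed.

Lemma gamma_pdfE (c : nat) : @gamma_pdf R c.+1 = erlang_pdf c \_ `]0, +oo[.
Proof.
apply/funext => x; rewrite /gamma_pdf !patchE; case: ifP => // _.
by rewrite Gamma_natr subn1 /erlang_pdf mulrAC.
Qed.

Variable c : nat.

Lemma gamma_pdf_ge0 (x : R) : 0 <= gamma_pdf c.+1 x.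
Proof.
rewrite gamma_pdfE patchE; case: ifPn => //.
by rewrite inE/= in_itv/= andbT => x0; rewrite erlang_pdf_ge0// ltW.
Qed.

Lemma measurable_gamma_pdf : measurable_fun [set: R] (gamma_pdf c.+1).
Proof.
rewrite gamma_pdfE; apply/(measurable_restrictT _ _).1 => //.
apply/measurable_funTS; apply: continuous_measurable_fun.
exact: continuous_erlang_pdf.
Qed.

Lemma gamma_probE (D : set R) :
  gamma_prob c.+1 D = (\int[mu]_(x in D `&` `]0%R, +oo[) (erlang_pdf c x)%:E)%E.
Proof.
rewrite /gamma_prob integral_mkcondr; apply: eq_integral => x _.
by rewrite gamma_pdfE restrict_EFin.
Qed.

Lemma gamma_prob_setT : gamma_prob c.+1 [set: R] = 1%E.
Proof.
rewrite gamma_probE setTI integral_itv_obnd_cbnd.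
  exact: integral_erlang_pdf.
exact: measurable_EFin_erlang_pdf.
Qed.

Lemma gamma_prob_cdf (t : R) : gamma_prob c.+1 `]-oo, t] =
  (erlang_cdf c.+1 t)%:E.
Proof.
rewrite /erlang_cdf.
have -> : gamma_prob c.+1 `]-oo, t] =
    (\int[mu]_(x in `]0%R, t]) (erlang_pdf c x)%:E)%E.
  rewrite gamma_probE; congr (integral _ _ _); apply/seteqP.
  by split=> x /=; rewrite !in_itv/= andbT; [case=> -> ->|case/andP=> -> ->].
have [t0|t0] := ltP 0 t.
  rewrite (ltW t0) integral_itv_obnd_cbnd.
    exact: integral_erlang_pdf_itv.
  exact: measurable_EFin_erlang_pdf.
rewrite set_itv_ge ?integral_set0 -?leNgt ?bnd_simp//.
case: ifPn => // t0'; have -> : t = 0 by apply/le_anti/andP.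
by rewrite erlang_ccdf0 subrr.
Qed.

Let gamma_prob0 : gamma_prob c.+1 set0 = 0%E :> \bar R.
Proof. exact: integral_set0. Qed.

Let gamma_prob_ge0 A : (0 <= gamma_prob c.+1 A :> \bar R)%E.
Proof. by apply: integral_ge0 => x _; rewrite lee_fin gamma_pdf_ge0. Qed.

Let gamma_prob_sigma_additive : semi_sigma_additive (@gamma_prob R c.+1).
Proof.
move=> /= F mF tF mUF; rewrite /gamma_prob; apply: cvg_toP.
  apply: ereal_nondecreasing_is_cvgn => p q pq.
  apply: lee_sum_nneg_natr => // k _ _; apply: integral_ge0 => /= x Fkx.
  by rewrite lee_fin gamma_pdf_ge0.
rewrite ge0_integral_bigcup//=.
- by apply/measurable_funTS/measurableT_comp => //; exact: measurable_gamma_pdf.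
- by move=> x _; rewrite lee_fin gamma_pdf_ge0.
Qed.

HB.instance Definition _ := isMeasure.Build _ _ _
  (@gamma_prob R c.+1) gamma_prob0 gamma_prob_ge0 gamma_prob_sigma_additive.

HB.instance Definition _ :=
  @Measure_isProbability.Build _ _ R (@gamma_prob R c.+1) gamma_prob_setT.

End gamma.

(** * Uniqueness of measures and integration against a density *)

(** Open right half-lines form a pi-system that generates the Borel sets. *)
Lemma probability_eq_cdf (R : realType) (P Q : probability R R) :
  (forall t : R, P `]-oo, t]%classic = Q `]-oo, t]%classic) ->
  forall A, measurable A -> P A = Q A.
Proof.
move=> PQ A mA; have PQr (t : R) : P `]t, +oo[%classic = Q `]t, +oo[%classic.
  by rewrite -setCitvl !probability_setC// PQ.
apply: (@measure_unique _ _ R (@RGenOInfty.G R) (fun n => `]- n%:R, +oo[%classic) _ _ _ _ P Q) => //.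
- exact: RGenOInfty.measurableE.
- move=> _ _ [x ->] [y ->]; exists (Order.max x y).
  by apply/seteqP; split=> z /=; rewrite !in_itv/= !andbT gt_max; [case=> -> ->|case/andP].
- by move=> n; exists (- n%:R).
- rewrite -subTset => x _; have := archi_boundP (normr_ge0 x).
  set n := Num.bound _ => xn; exists n => //=; rewrite in_itv/= andbT ltrNl.
  by apply: le_lt_trans xn; rewrite -normrN ler_norm.
- by move=> _ [t ->]; exact: PQr.
- by move=> n; rewrite (le_lt_trans (probability_le1 _ _)) ?ltry.
Qed.

(** Rectangles form a pi-system that generates the product sigma-algebra. *)
Lemma finite_measure_eq_rectangles (d1 d2 : measure_display)
    (T1 : measurableType d1) (T2 : measurableType d2) (R : realType)
    (m1 m2 : {measure set (T1 * T2) -> \bar R}) : (m1 setT < +oo)%E ->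
  (forall A B, measurable A -> measurable B -> m1 (A `*` B) = m2 (A `*` B)) ->
  forall W, measurable W -> m1 W = m2 W.
Proof.
move=> m1oo m12; pose C : set (set (T1 * T2)) :=
  [set C | exists A, measurable A /\ exists B, measurable B /\ C = A `*` B].
apply: (measure_unique C (fun=> setT)) => //.
- rewrite measurable_prod_measurableType //; congr (<<s _ >>).
  rewrite predeqE; split => [[A mA [B mB <-]]|[A [mA [B [mB ->]]]]].
    by exists A; split => //; exists B.
  by exists A => //; exists B.
- move=> _ _ [X1 [mX1 [X2 [mX2 ->]]]] [Y1 [mY1 [Y2 [mY2 ->]]]].
  rewrite -setXI; exists (X1 `&` Y1); split; first exact: measurableI.
  by exists (X2 `&` Y2); split => //; exact: measurableI.
- by move=> _; exists setT; split => //; exists setT; rewrite setXTT.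
- by rewrite bigcup_const//; exists 0%N.
- by move=> _ [A [mA [B [mB ->]]]]; exact: m12.
Qed.

(** The density is a Radon-Nikodym derivative, and these are unique up to null
    sets. *)
Lemma integral_density (d : measure_display) (T : measurableType d) (R : realType)
    (mu : {sigma_finite_measure set T -> \bar R}) (nu : {finite_measure set T -> \bar R})
    (f : T -> R) :
  measurable_fun setT f ->
  (forall A, measurable A -> nu A = \int[mu]_(x in A) (f x)%:E)%E ->
  forall g : T -> \bar R, nu.-integrable setT g ->
  (\int[nu]_x g x = \int[mu]_x (g x * (f x)%:E))%E.
Proof.
move=> mf nuE g gi.
have mfE (D : set T) : measurable_fun D (fun x => (f x)%:E).
  by apply/measurable_EFinP; exact: measurable_funTS.
have nu_mu : nu `<< mu.
  apply/null_content_dominatesP => A mA muA0.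
  by rewrite nuE// null_set_integral.
rewrite -(Radon_Nikodym_change_of_variables nu_mu)//=.
apply: ae_eq_integral => //.
- by apply: emeasurable_funM => //; exact: measurable_int gi.
- by apply: emeasurable_funM => //; exact: measurable_int gi.
- apply: ae_eqe_mul2l => /=.
  rewrite Radon_NikodymE//=.
  case: cid => /= h [h1 h2 h3]; apply: integral_ae_eq => //=.
  by move=> E _ mE; rewrite -h3//; exact: nuE.
Qed.

(** * Sums of independent exponential variables *)

Section pairRV.
Context d (T : measurableType d) d1 (T1 : measurableType d1)
  d2 (T2 : measurableType d2).

Definition pairRV (X : {mfun T >-> T1}) (Y : {mfun T >-> T2}) : T -> T1 * T2 :=
  fun w => (X w, Y w).

Variables (X : {mfun T >-> T1}) (Y : {mfun T >-> T2}).

Let measurable_pairRV : measurable_fun setT (pairRV X Y).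
Proof. by apply: measurable_fun_pair; exact: measurable_funPT. Qed.

HB.instance Definition _ :=
  isMeasurableFun.Build _ _ _ _ (pairRV X Y) measurable_pairRV.

End pairRV.

Section borelRV.
Context d (T : measurableType d) (R : realType).

(** The Lebesgue measure lives on [measurableTypeR R], which has the same
    measurable sets as [R] but another display; this moves a random variable
    there. *)
Definition borelRV (X : {mfun T >-> R}) : T -> measurableTypeR R := X.

Variable X : {mfun T >-> R}.

Let measurable_borelRV : measurable_fun setT (borelRV X).
Proof. move=> mT B mB; exact: (measurable_funPT X). Qed.

HB.instance Definition _ :=
  isMeasurableFun.Build _ _ _ _ (borelRV X) measurable_borelRV.

End borelRV.

Section set_sumRV.
Context d (T : measurableType d) (R : realType) (I : finType).

(** Sums over subsets of the index type allow an induction that removes one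
    variable at a time without ordering the variables. *)
Definition set_sumRV (E : I -> {mfun T >-> R}) (J : {set I}) : T -> R :=
  fun w => \sum_(i in J) E i w.

Variables (E : I -> {mfun T >-> R}) (J : {set I}).

Let measurable_set_sumRV : measurable_fun setT (set_sumRV E J).
Proof.
rewrite (_ : set_sumRV E J = fun w => \sum_(i <- enum J) E i w).
  by apply: measurable_sum => i; exact: measurable_funPT.
by apply/funext => w; rewrite /set_sumRV big_enum.
Qed.

HB.instance Definition _ :=
  isMeasurableFun.Build _ _ _ _ (set_sumRV E J) measurable_set_sumRV.

End set_sumRV.

Section erlang_convolution.
Context {R : realType}.
Notation mu := (@lebesgue_measure R).

(** On [[0, t]] the integrand [exp (- y) * (1 - erlang_ccdf n (t - y))] has the
    antiderivative [exp (- y) * (erlang_ccdf n.+1 (t - y) - 1)], which vanishes at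
    [y = t]; elsewhere the integrand is zero. *)
Lemma erlang_cdf_conv (n : nat) (t : R) :
  (\int[mu]_y ((erlang_cdf n (t - y))%:E * (exponential_pdf 1 y)%:E) =
   (erlang_cdf n.+1 t)%:E)%E.
Proof.
have -> : (\int[mu]_y ((erlang_cdf n (t - y))%:E * (exponential_pdf 1 y)%:E) =
    \int[mu]_(y in `[0%R, t]) (expR (- y) * (1 - erlang_ccdf n (t - y)))%:E)%E.
  rewrite [RHS]integral_mkcond; apply: eq_integral => y _.
  rewrite patchE -EFinM /erlang_cdf subr_ge0 /exponential_pdf patchE !mem_setE.
  rewrite !in_itv/= andbT mulN1r mul1r.
  by case: (0 <= y); case: (y <= t); rewrite /= ?(mulr0, mul0r)// mulrC.
rewrite /erlang_cdf; have [t0|t0|<-] := ltgtP 0 t; last 2 first.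
- by rewrite set_itv_ge ?integral_set0// bnd_simp -ltNge.
- by rewrite set_itv1 integral_set1 erlang_ccdf0 subrr.
pose A y : R := expR (- y) * (erlang_ccdf n.+1 (t - y) - 1).
have dA (y : R) : is_derive y 1 A (expR (- y) * (1 - erlang_ccdf n (t - y))).
  have d1 : is_derive y 1 (fun z : R => expR (- z)) (- expR (- y)).
    by rewrite -[X in is_derive _ _ _ X](mulrN1); apply: is_derive1_comp.
  have d2 : is_derive y 1 (fun z : R => erlang_ccdf n.+1 (t - z) - 1) (erlang_pdf n (t - y)).
    have d3 : is_derive y 1 (fun z : R => t - z) (- 1).
      by apply: (is_derive_eq (is_deriveB (is_derive_cst t y 1) (is_derive_id y 1)));
        exact: sub0r.
    have d4 := @is_derive1_comp _ _ _ y _ _ (is_derive_erlang_ccdf n (t - y)) d3.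
    have := is_deriveB d4 (is_derive_cst (1 : R) y 1).
    by rewrite mulrN1 opprK subr0.
  apply: (is_derive_eq (is_deriveM d1 d2)).
  by rewrite /GRing.scale/= erlang_ccdfS; ring.
rewrite (@continuous_FTC2 _ _ A)//.
- rewrite /A subrr subr0 erlang_ccdf0 subrr mulr0 oppr0 expR0 mul1r -EFinB.
  by rewrite sub0r opprB.
- apply: continuous_subspaceT => y; apply: cvgM.
    by apply: continuous_comp; [exact: cvgN|exact: continuous_expR].
  apply: cvgB; first exact: cvg_cst.
  apply: (@continuous_comp _ _ _ (fun z : R => t - z) (@erlang_ccdf R n)).
    by apply: cvgB; [exact: cvg_cst|exact: cvg_id].
  exact: continuous_erlang_ccdf.
- have cA : continuous A by move=> y; exact: is_derive_continuous (dA y).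
  split.
  + by move=> y _; exact: (@ex_derive _ _ _ _ _ _ _ (dA y)).
  + by apply: cvg_at_right_filter; exact: cA.
  + by apply: cvg_at_left_filter; exact: cA.
- by move=> y _; rewrite derive1E (@derive_val _ _ _ _ _ _ _ (dA y)).
Qed.

End erlang_convolution.

(** Independence makes the joint law of [(Y, X)] the product law, and the section
    at [y] of the half-plane under the line [x + y = t] is the half-line
    []-oo, t - y]], so that the distribution function of the sum is a
    convolution. *)
Lemma cdf_add_exponential (d : measure_display) (T : measurableType d) (R : realType)
    (P : probability T R) (X Y : {mfun T >-> measurableTypeR R}) (n : nat) :
  (forall A B, measurable A -> measurable B ->
     P (Y @^-1` A `&` X @^-1` B) = P (Y @^-1` A) * P (X @^-1` B))%E ->
  (forall A, measurable A -> P (Y @^-1` A) = exponential_prob 1 A) ->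
  (forall t, P (X @^-1` `]-oo, t]) = (erlang_cdf n t)%:E) ->
  forall t, P [set w | (Y w : R) + X w <= t] = (erlang_cdf n.+1 t)%:E.
Proof.
move=> XY lawY cdfX t.
pose W := [set z : measurableTypeR R * measurableTypeR R | (z.1 : R) + z.2 <= t].
have mW : measurable W.
  have mD : measurable_fun setT
      (fun z : measurableTypeR R * measurableTypeR R => (z.1 : R) + z.2).
    by apply: measurable_funD; [exact: measurable_fst|exact: measurable_snd].
  have := mD measurableT `]-oo, t]%classic (measurable_itv _).
  rewrite setTI; congr measurable; apply/seteqP; split=> z /=; by rewrite in_itv.
have prodW : (distribution P Y \x distribution P X)%E W = P [set w | (Y w : R) + X w <= t].
  symmetry; apply: (@finite_measure_eq_rectangles _ _ _ _ _
    (distribution P (pairRV Y X)) (distribution P Y \x distribution P X)%E) => //.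
    by rewrite (le_lt_trans (probability_le1 _ _)) ?ltry.
  by move=> A B mA mB; rewrite /= product_measure1E// -XY.
have xsecE : (fun y => (distribution P X \o xsection W) y) =
    (fun y => (erlang_cdf n (t - y))%:E).
  apply/funext => y; rewrite /= -cdfX; congr (P _); apply/seteqP.
  by split=> w; rewrite /= /xsection /= inE in_itv/= lerBrDl.
rewrite -prodW /product_measure1 xsecE -erlang_cdf_conv.
apply: integral_density.
- exact: measurable_exponential_pdf.
- by move=> A mA; exact: lawY.
- rewrite -xsecE; apply/integrableP; split; first exact: measurable_fun_xsection.
  under eq_integral do rewrite gee0_abs//.
  rewrite -[X in (X < _)%E]/((distribution P Y \x distribution P X)%E W) prodW.
  by rewrite (le_lt_trans (probability_le1 _ _)) ?ltry// -[X in measurable X]/((pairRV Y X) @^-1` W); exact: measurable_funPTI.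
Qed.

Section independent_sums.
Context d (T : measurableType d) (R : realType) (P : probability T R) (I : finType).
Variable E : I -> {RV P >-> R}.

Let event (K : {set I}) (A : I -> set R) := \bigcap_(i in [set` K]) (E i @^-1` A i).

Let measurable_event K A : (forall i, measurable (A i)) -> measurable (event K A).
Proof.
move=> mA; apply: fin_bigcap_measurable => // i _; exact: measurable_funPTI.
Qed.

Lemma set_sumRV0 : set_sumRV E finset.set0 = cst 0.
Proof. by apply/funext => w; rewrite /set_sumRV big_set0. Qed.

Lemma set_sumRVU1 (j : I) (J : {set I}) : j \notin J ->
  set_sumRV E (j |: J) = fun w => E j w + set_sumRV E J w.
Proof. by move=> jJ; apply/funext => w; rewrite /set_sumRV big_setU1. Qed.

Lemma event1 (j : I) (A : I -> set R) : event [set j]%SET A = E j @^-1` A j.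
Proof.
by apply/seteqP; split=> w /= H; [apply: H; rewrite /= inE|move=> i /=; rewrite inE => /eqP ->].
Qed.

Lemma eventU1 (j : I) (K : {set I}) (A : I -> set R) :
  event (j |: K) A = E j @^-1` A j `&` event K A.
Proof.
apply/seteqP; split=> w /=.
  move=> H; split=> [|i iK]; apply: H; rewrite /= ?setU11// inE.
  by apply/orP; right.
by move=> [Hj HK] i /=; rewrite !inE => /orP[/eqP ->//|]; exact: HK.
Qed.

Hypothesis indep : mutually_independent E.

(** Adjoin an index [j] to the sum.  On rectangles, the law of [(E j, S)]
    restricted to the event is, by the case without [j], a constant multiple of
    the law of [(E j, S)]; so these two measures also agree on the preimage of [B]
    under addition. *)
Lemma independent_set_sumRV (J K : {set I}) (B : set R) (A : I -> set R) :
  [disjoint J & K]%B -> measurable B -> (forall i, measurable (A i)) ->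
  P (set_sumRV E J @^-1` B `&` event K A) =
  (P (set_sumRV E J @^-1` B) * P (event K A))%E.
Proof.
elim: {J}#|J| {-2}J (erefl #|J|) K B A => [J /eqP J0|n IHn J cJ] K B A JK mB mA.
  move: J0; rewrite cards_eq0 => /eqP ->; rewrite set_sumRV0 preimage_cst.
  by case: ifP => _; rewrite ?setTI ?set0I ?probability_setT ?mul1e ?measure0 ?mul0e.
have [j jJ] : exists j, j \in J by apply/finset.set0Pn; rewrite -cards_eq0 cJ.
have cJ' : #|(J :\ j)%SET| = n by have := cardsD1 j J; rewrite jJ cJ => -[].
have jK : j \notin K by rewrite (disjointFr JK jJ).
have JK' : [disjoint (J :\ j)%SET & K]%B.
  by apply: disjointWl JK; exact: subsetDl.
have jJ' : j \notin (J :\ j)%SET by rewrite !inE eqxx.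
set S := set_sumRV E (J :\ j)%SET.
have mD : measurable (event K A) by exact: measurable_event.
have [p p0 pE] : exists2 p : R, 0 <= p & P (event K A) = p%:E.
  exists (fine (P (event K A))); first exact: fine_ge0.
  by rewrite fineK// fin_num_measure.
pose Z := pairRV (E j) S.
pose m1 := pushforward (mrestr P mD) Z.
pose m2 := pushforward (mscale (NngNum p0) P) Z.
have mW : measurable [set z : R * R | B (z.1 + z.2)].
  have mF : measurable_fun setT (fun z : R * R => z.1 + z.2).
    by apply: measurable_funD; [exact: measurable_fst|exact: measurable_snd].
  by have := mF measurableT B mB; rewrite setTI.
have m12 : m1 [set z : R * R | B (z.1 + z.2)] = m2 [set z : R * R | B (z.1 + z.2)].
  apply: (@finite_measure_eq_rectangles _ _ _ _ _ m1 m2) => //.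
    rewrite /m1 /pushforward /mrestr (le_lt_trans (probability_le1 _ _)) ?ltry//.
    by apply: measurableI => //; rewrite preimage_setT.
  move=> X Y mX mY; pose A' i := if i == j then X else A i.
  have mA' i : measurable (A' i) by rewrite /A'; case: ifP.
  have A'K : event K A' = event K A.
    apply: eq_bigcapr => i /= iK; rewrite /A'; case: eqP => // ij.
    by move: iK; rewrite ij (negbTE jK).
  have Zrect : Z @^-1` (X `*` Y) = S @^-1` Y `&` event [set j]%SET A'.
    by rewrite event1 /A' eqxx setIC.
  suff : P (Z @^-1` (X `*` Y) `&` event K A) =
      (P (event K A) * P (Z @^-1` (X `*` Y)))%E by rewrite pE.
  rewrite Zrect [RHS]muleC.
  have -> : S @^-1` Y `&` event [set j]%SET A' `&` event K A =
      S @^-1` Y `&` event (j |: K) A'.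
    by rewrite eventU1 event1 A'K setIA.
  rewrite !IHn//; last 2 first.
  - by rewrite disjoint_sym disjoints1.
  - apply/pred0P => i; rewrite /= !inE; case: eqP => //= _.
    exact: (pred0P JK i).
  rewrite -muleA; congr (_ * _)%E.
  by rewrite -A'K /event !indep// big_setU1//= big_set1.
have SE : set_sumRV E J @^-1` B = Z @^-1` [set z : R * R | B (z.1 + z.2)].
  by rewrite -(finset.setD1K jJ) set_sumRVU1.
by rewrite SE pE [RHS]muleC.
Qed.

Hypothesis exponential : forall i A, measurable A ->
  distribution P (E i) A = exponential_prob 1 A.

Lemma cdf_set_sumRV (J : {set I}) (t : R) :
  P (set_sumRV E J @^-1` `]-oo, t]) = (erlang_cdf #|J| t)%:E.
Proof.
elim: {J}#|J| {-2}J (erefl #|J|) t => [J /eqP J0|n IHn J cJ] t.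
  move: J0; rewrite cards_eq0 => /eqP ->; rewrite set_sumRV0 preimage_cst.
  rewrite cards0 /erlang_cdf /erlang_ccdf big_ord0 mulr0 subr0.
  rewrite mem_setE in_itv/=.
  by case: ifP => _; rewrite ?probability_setT ?measure0.
have [j jJ] : exists j, j \in J by apply/finset.set0Pn; rewrite -cards_eq0 cJ.
have cJ' : #|(J :\ j)%SET| = n by have := cardsD1 j J; rewrite jJ cJ => -[].
have jJ' : j \notin (J :\ j)%SET by rewrite !inE eqxx.
rewrite cJ -(@cdf_add_exponential _ _ _ P
  (borelRV (set_sumRV E (J :\ j)%SET)) (borelRV (E j)) n).
- by rewrite -{1}(finset.setD1K jJ) set_sumRVU1//; congr (P _); apply/seteqP; split=> w /=; rewrite in_itv.
- move=> A B mA mB; rewrite setIC muleC -[borelRV (E j) @^-1` A]/(E j @^-1` (fun=> A) j).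
  rewrite -event1; apply: independent_set_sumRV => //.
  by rewrite disjoint_sym disjoints1.
- by move=> A mA; exact: exponential.
- by move=> s; rewrite -cJ'; exact: IHn.
Qed.

End independent_sums.

(** * Convergence in distribution *)

Lemma probability_le_nat (d : measure_display) (T : measurableType d) (R : realType)
    (P : probability T R) (Y : {RV P >-> nat}) (p : nat -> R) :
  (forall y, distribution P Y [set y] = (p y)%:E) ->
  forall y, P [set w | (Y w <= y)%N] = (\sum_(i < y.+1) p i)%:E.
Proof.
move=> Yp; have mY (A : set nat) : measurable (Y @^-1` A) by exact: measurable_funPTI.
elim=> [|y IHy].
  by rewrite big_ord1 -Yp; congr (P _); apply/seteqP; split=> w /=; rewrite leqn0 => /eqP.
rewrite big_ord_recr EFinD/= -IHy -Yp -measureU//.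
- congr (P _); apply/seteqP; split=> w /=.
    by rewrite leq_eqVlt ltnS => /orP[/eqP|]; [right|left].
  by case=> [/leqW//|->].
- exact: (mY [set i | (i <= y)%N]).
- by apply/seteqP; split=> w //= [H1 H2]; move: H1; rewrite H2 ltnn.
Qed.

Section limit.
Context (R : realType) (c : nat) (theta : R) (N m : nat -> nat).
Hypotheses (c0 : (0 < c)%N) (theta0 : 0 < theta).
Hypothesis N_cvg : N k @[k --> \oo] --> \oo.
Hypothesis m_cvg : (m k)%:R / (theta * Num.sqrt (N k)%:R) @[k --> \oo] --> (1 : R).
Hypotheses (N0 : forall k, (0 < N k)%N) (cm : forall k, (c <= m k)%N).
Hypothesis cM : forall k, (c <= N k - m k)%N.
Context (d : nat -> measure_display) (T : forall k, measurableType (d k)).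
Context (P : forall k, probability (T k) R) (Y : forall k, {RV (P k) >-> nat}).
Hypothesis Y_law : forall k, has_max_neg_hypergeo_law (N k) (m k) c (Y k).

(** For [x >= 0] the event [theta * Y / sqrt N <= x] is [Y <= y] with [y] the
    integral part of [x * sqrt N / theta], which eventually lies in the range
    where the mass function is given by its formula. *)
Lemma cvg_cdf_normalized (x : R) :
  cdf (normalized theta (N k) (Y k) : {RV (P k) >-> R}) x @[k --> \oo] -->
  (erlang_cdf c x)%:E.
Proof.
have s0 k : 0 < Num.sqrt (N k)%:R :> R by rewrite sqrtr_gt0 ltr0n.
rewrite /erlang_cdf; case: ifPn => [x0|]; last first.
  rewrite -ltNge => x0; apply: cvg_near_cst; near=> k.
  rewrite /cdf /distribution /pushforward -[RHS](measure0 (P k)); congr (P k _).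
  apply/seteqP; split=> // w /=; rewrite in_itv/= => Yx.
  have : 0 <= normalized theta (N k) (Y k) w.
    by rewrite /normalized divr_ge0 ?sqrtr_ge0// mulr_ge0// ltW.
  by move=> /le_trans/(_ Yx); rewrite leNgt x0.
pose y k := Num.truncn (x * Num.sqrt (N k)%:R / theta).
have z0 k : 0 <= x * Num.sqrt (N k)%:R / theta.
  by rewrite divr_ge0 ?(ltW theta0)// mulr_ge0 ?sqrtr_ge0.
have soo := cvg_sqrt_natr_pinfty (R := R) N_cvg.
have sV : (Num.sqrt (N k)%:R)^-1 @[k --> \oo] --> (0 : R).
  by apply: (gtr0_cvgV0 _).2 soo; near=> k.
have y_cvg : (y k)%:R / Num.sqrt (N k)%:R @[k --> \oo] --> x / theta.
  apply: (@squeeze_cvgr _ _ _ _ (fun k => x / theta - (Num.sqrt (N k)%:R)^-1)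
    (fun=> x / theta)); last exact: cvg_cst.
    near=> k; have /andP[yle ylt] := truncn_itv (z0 k).
    have -> : x / theta = x * Num.sqrt (N k)%:R / theta / Num.sqrt (N k)%:R.
      by field; rewrite !gt_eqF.
    have B1 (a b : R) : a / b - b^-1 = (a - 1) / b by rewrite mulrBl mul1r.
    by rewrite B1 !ler_pM2r ?invr_gt0// lerBlDr natr1 (ltW ylt) yle.
  apply: (eq_near_cvg (cvgB (cvg_cst (x / theta)) sV)); first exact: subr0.
  by near=> k.
have n_cvg : (2 * c + y k)%:R / Num.sqrt (N k)%:R @[k --> \oo] --> x / theta.
  apply: (eq_near_cvg (cvgD (cvgMl_tmp (a := (2 * c)%:R) sV) y_cvg)).
  - by rewrite mulr0 add0r.
  - by near=> k; rewrite /= natrD mulrDl.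
have m_cvg' : (m k)%:R / Num.sqrt (N k)%:R @[k --> \oo] --> theta.
  apply: (eq_near_cvg (cvgMl_tmp (a := theta) m_cvg)); first exact: mulr1.
  by near=> k; rewrite invfM mulrCA mulVKf ?gt_eqF.
have mN k : (m k <= N k)%N by have := cM k; lia.
have lim : 1 - undecided R (N k) (m k) c (2 * c + y k) @[k --> \oo] -->
    1 - erlang_ccdf c x.
  apply: cvgB; first exact: cvg_cst.
  rewrite -[x in erlang_ccdf c x](divfK (lt0r_neq0 theta0)) mulrC.
  by apply: (cvg_undecided c0 N_cvg m_cvg' n_cvg) => // k; exact: leq_addr.
have cdfE : \forall k \near \oo, (1 - undecided R (N k) (m k) c (2 * c + y k))%:E =
    cdf (normalized theta (N k) (Y k) : {RV (P k) >-> R}) x.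
  near=> k; have room : (m k + (2 * c + y k) + 0 < N k)%N.
    by near: k; exact: (near_room N_cvg m_cvg' n_cvg).
  rewrite -sum_max_neg_hypergeo_pmf//; last by lia.
  rewrite -(probability_le_nat (Y_law k)) /cdf /distribution /pushforward.
  have le_norm (i : nat) : (theta * i%:R / Num.sqrt (N k)%:R <= x) = (i <= y k)%N.
    by rewrite truncn_ge_nat// ler_pdivrMr// ler_pdivlMr// mulrC.
  congr (P k _); apply/seteqP.
  by split=> w /=; rewrite in_itv/= /normalized le_norm.
apply: cvg_trans (near_eq_cvg cdfE) _; apply: cvg_EFin; first by near=> k.
exact: lim.
Unshelve. all: by end_near. Qed.

End limit.

Lemma law_sumRV_exponential (R : realType) (c : nat) (d : measure_display)
    (T : measurableType d) (P : probability T R) (E : 'I_c -> {RV P >-> R}) :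
  (0 < c)%N -> mutually_independent E ->
  (forall i A, measurable A -> distribution P (E i) A = exponential_prob 1 A) ->
  forall A, measurable A -> distribution P (sumRV E) A = gamma_prob c A.
Proof.
case: c E => // c E _ indep expE.
apply: (probability_eq_cdf (P := distribution P (sumRV E))
  (Q := @gamma_prob R c.+1)) => t.
rewrite [RHS]gamma_prob_cdf -[c.+1 in RHS]card_ord -cardsT.
rewrite -(cdf_set_sumRV indep expE); congr (P _).
have SE : sumRV E = set_sumRV E [set: 'I_c.+1]%SET.
  by apply/funext => w; apply: eq_bigl => i; rewrite inE.
by apply/seteqP; split=> w /=; rewrite SE.
Qed.

Theorem lemma2 (R : realType) (c : nat) (c_ge1 : (1 <= c)%N)
  (theta : R) (theta_gt0 : 0 < theta)
  (N m : nat -> nat)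
  (N_gt0 : forall k, (0 < N k)%N) (m_gt0 : forall k, (0 < m k)%N)
  (N_cvg : N @ \oo --> \oo)
  (m_cvg : (m k)%:R / (theta * Num.sqrt (N k)%:R) @[k --> \oo] --> (1 : R))
  (c_le_m : forall k, (c <= m k)%N)
  (c_le_Nm : forall k, (c <= N k - m k)%N)
  (d : nat -> measure_display) (T : forall k, measurableType (d k))
  (P : forall k, probability (T k) R) (Y : forall k, {RV (P k) >-> nat})
  (Y_law : forall k, has_max_neg_hypergeo_law (N k) (m k) c (Y k)) :
  cvg_in_distribution (P := P) (fun k => normalized theta (N k) (Y k))
    (@gamma_prob R c) /\
  (forall (d' : measure_display) (T' : measurableType d')
     (P' : probability T' R) (E : 'I_c -> {RV P' >-> R}),
   mutually_independent E ->
   (forall i A, measurable A ->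
      distribution P' (E i) A = exponential_prob 1 A) ->
   cvg_in_distribution (P := P) (fun k => normalized theta (N k) (Y k))
     (distribution P' (sumRV E)) /\
   (forall A, measurable A ->
      distribution P' (sumRV E) A = gamma_prob c A)).
Proof.
have cvg_gamma (x : R) :
    cdf (normalized theta (N k) (Y k) : {RV (P k) >-> R}) x @[k --> \oo] -->
    gamma_prob c `]-oo, x].
  case: c c_ge1 c_le_m c_le_Nm Y_law => // c' _ cm cM law.
  by rewrite gamma_prob_cdf; apply: cvg_cdf_normalized => //.
split=> [x _|d' T' P' E indep expE]; first exact: cvg_gamma.
have lawE := law_sumRV_exponential c_ge1 indep expE.
by split=> // x _; rewrite lawE.
Qed.
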